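(* Let $(L,\theta_L)$ be a 3-LieDer pair and let $(f_t,g_t)$ and $(f'_t,g'_t)$ be two equivalent one-parameter formal deformations of $(L,\theta_L)$. Let $n\ge 1$ and suppose $(f_i,g_i)=0=(f'_i,g'_i)$ for all $1\le i<n$, so that $(f_n,g_n)$ and $(f'_n,g'_n)$ are the $n$-infinitesimals of $(f_t,g_t)$ and $(f'_t,g'_t)$. Then $(f_n,g_n)$ and $(f'_n,g'_n)$ belong to the same cohomology class in $\mathcal H^2_{\rm 3-LieDer}(L;L)$.
   Context: Throughout, $\mathbb F$ is an algebraically closed field of characteristic $0$ and all vector spaces (such as $L$) are finite-dimensional over $\mathbb F$. A 3-Lie algebra is a vector space $L$ with a skew-symmetric trilinear map $[\cdot,\cdot,\cdot]_L$ satisfying $[x_1,x_2,[x_3,x_4,x_5]]=[[x_1,x_2,x_3],x_4,x_5]+[x_3,[x_1,x_2,x_4],x_5]+[x_3,x_4,[x_1,x_2,x_5]]$. A derivation is a linear map $\theta_L:L\to L$ with $\theta_L[x,y,z]=[\theta_L x,y,z]+[x,\theta_L y,z]+[x,y,\theta_L z]$. A 3-LieDer pair $(L,\theta_L)$ is a 3-Lie algebra together with a derivation. Cohomology in low degrees with coefficients in the adjoint representation $(L;\mathrm{ad},\theta_L)$, $\mathrm{ad}(x,y)z=[x,y,z]_L$: $\mathcal C^1_{\rm 3-LieDer}(L;L)=\mathrm{Hom}(L,L)$, $\mathcal C^2_{\rm 3-LieDer}(L;L)=\mathrm{Hom}(\wedge^3L,L)\times\mathrm{Hom}(L,L)$.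 For $\alpha\in\mathrm{Hom}(L,L)$: $(\mathrm d\alpha)(x,y,z)=-\alpha([x,y,z]_L)+[x,y,\alpha(z)]_L+[\alpha(x),y,z]_L+[x,\alpha(y),z]_L$ and $(\delta\alpha)(z)=\alpha(\theta_L z)-\theta_L(\alpha(z))$. For $f\in\mathrm{Hom}(\wedge^3L,L)$: $(\delta f)(x,y,z)=f(\theta_Lx,y,z)+f(x,\theta_Ly,z)+f(x,y,\theta_Lz)-\theta_L f(x,y,z)$ and $$\begin{aligned}(\mathrm df)(x_1,x_2,x_3,x_4,x_5)=&-f([x_1,x_2,x_3],x_4,x_5)-f(x_3,[x_1,x_2,x_4],x_5)-f(x_3,x_4,[x_1,x_2,x_5])+f(x_1,x_2,[x_3,x_4,x_5])\\&+[x_1,x_2,f(x_3,x_4,x_5)]-[x_3,x_4,f(x_1,x_2,x_5)]-[f(x_1,x_2,x_3),x_4,x_5]-[x_3,f(x_1,x_2,x_4),x_5].\end{aligned}$$ The coboundary is $\partial\alpha=(\mathrm d\alpha,-\delta\alpha)$ on degree 1 and $\partial(f,g)=(\mathrm df,\mathrm dg+\delta f)$ on degree 2. $\mathcal H^2_{\rm 3-LieDer}(L;L)=\ker(\partial|_{\mathcal C^2})/\partial(\mathcal C^1)$. A one-parameter formal deformation of $(L,[\cdot,\cdot,\cdot]_L,\theta_L)$ is a pair of formal power series $f_t=\sum_{i\ge0}f_it^i$, $g_t=\sum_{i\ge0}g_it^i$ with $f_i\in\mathrm{Hom}(\wedge^3L,L)$, $g_i\in\mathrm{Hom}(L,L)$,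 $f_0=[\cdot,\cdot,\cdot]_L$, $g_0=\theta_L$, such that $(L[[t]],f_t,g_t)$ is a 3-LieDer pair over $\mathbb F[[t]]$. If $(f_i,g_i)=0$ for all $1\le i<n$, then $(f_n,g_n)$ is called the $n$-infinitesimal of $(f_t,g_t)$; it is a 2-cocycle. Two deformations $(f_t,g_t)$, $(f'_t,g'_t)$ are equivalent, $(f_t,g_t)\sim(f'_t,g'_t)$, if there is $\Phi_t=\sum_{i\ge0}\phi_it^i:(L[[t]],f'_t,g'_t)\to(L[[t]],f_t,g_t)$ with $\phi_i\in\mathrm{Hom}(L,L)$, $\phi_0=\mathrm{id}_L$, such that $\Phi_t\circ f'_t=f_t\circ(\Phi_t\times\Phi_t\times\Phi_t)$ and $\Phi_t\circ g'_t=g_t\circ\Phi_t$. *)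

(* Defs.v *)
From HB Require Import structures.
From mathcomp Require Import all_boot all_order all_algebra.
From mathcomp Require Import boolp ring.

Set Implicit Arguments.
Unset Strict Implicit.
Unset Printing Implicit Defensive.

Import GRing.Theory.
Local Open Scope ring_scope.

(* Stated over any commutative ring: L is a 3-LieDer pair over F, whereas a  *)
(* deformation is one over F[[t]].                                           *)

Section ThreeLieDer.
Variables (R : comNzRingType) (M : lmodType R).
Implicit Types (br : M -> M -> M -> M) (theta : M -> M).

Definition trilinear br : Prop :=
  [/\ forall y z, linear (fun x => br x y z),
      forall x z, linear (fun y => br x y z)
    & forall x y, linear (fun z => br x y z)].

(* The two adjacent transpositions generate the symmetric group S_3. *)
Definition skew_symmetric br : Prop :=
  (forall x y z, br y x z = - br x y z) /\
  (forall x y z, br x z y = - br x y z).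

Definition fundamental_identity br : Prop :=
  forall x1 x2 x3 x4 x5,
    br x1 x2 (br x3 x4 x5) =
      br (br x1 x2 x3) x4 x5 + br x3 (br x1 x2 x4) x5
      + br x3 x4 (br x1 x2 x5).

Definition is_3Lie br : Prop :=
  [/\ trilinear br, skew_symmetric br & fundamental_identity br].

Definition is_derivation br theta : Prop :=
  linear theta /\
  forall x y z, theta (br x y z) =
    br (theta x) y z + br x (theta y) z + br x y (theta z).

Definition is_3LieDer br theta : Prop := is_3Lie br /\ is_derivation br theta.

End ThreeLieDer.

(* Formal power series: fps V is V[[t]]; fps R is a ring when R is, and      *)
(* fps M is an (fps R)-module when M is an R-module.                         *)

Record fps (V : Type) := Fps { fps_coef :> nat -> V }.

HB.instance Definition _ (V : Type) := gen_eqMixin (fps V).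
HB.instance Definition _ (V : Type) := gen_choiceMixin (fps V).

Lemma fpsP (V : Type) (u v : fps V) : (forall n, u n = v n) -> u = v.
Proof. by case: u v => [u] [v] /= uv; congr Fps; apply/funext. Qed.

(* The Cauchy product of two series along a bi-additive operation. *)
Definition cauchy (U V : Type) (W : zmodType) (op : U -> V -> W)
    (u : fps U) (v : fps V) : fps W :=
  Fps (fun n => \sum_(i < n.+1) op (u i) (v (n - i)%N)).

Lemma cauchy_rev (U V : Type) (W : zmodType) (op : U -> V -> W) u v n :
  cauchy op u v n = \sum_(i < n.+1) op (u (n - i)%N) (v i).
Proof.
rewrite /= (reindex_inj rev_ord_inj); apply: eq_bigr => i _ /=.
by rewrite subSS subKn ?leq_ord.
Qed.

Section FpsZmodule.
Variable V : zmodType.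
Implicit Types u v w : fps V.

Definition fps_zero : fps V := Fps (fun=> 0).
Definition fps_opp u : fps V := Fps (fun n => - u n).
Definition fps_add u v : fps V := Fps (fun n => u n + v n).

Fact fps_addA : associative fps_add.
Proof. by move=> u v w; apply: fpsP => n /=; rewrite addrA. Qed.
Fact fps_addC : commutative fps_add.
Proof. by move=> u v; apply: fpsP => n /=; rewrite addrC. Qed.
Fact fps_add0 : left_id fps_zero fps_add.
Proof. by move=> u; apply: fpsP => n /=; rewrite add0r. Qed.
Fact fps_addN : left_inverse fps_zero fps_opp fps_add.
Proof. by move=> u; apply: fpsP => n /=; rewrite addNr. Qed.

HB.instance Definition _ :=
  GRing.isZmodule.Build (fps V) fps_addA fps_addC fps_add0 fps_addN.

End FpsZmodule.

Section FpsScale.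
Variables (R : comNzRingType) (M : lmodType R).
Implicit Types (a b : fps R) (u v : fps M).

Definition fps_one : fps R := Fps (fun n => (n == 0%N)%:R).
Definition fps_mul a b : fps R := cauchy *%R a b.
Definition fps_scale a u : fps M := cauchy *:%R a u.

Fact fps_scaleA a b u : fps_scale a (fps_scale b u) = fps_scale (fps_mul a b) u.
Proof.
apply: fpsP => n; rewrite [RHS]cauchy_rev [LHS]/=.
pose c (j k : nat) := (a j * b (n - j - k)%N) *: u k.
transitivity (\sum_(j < n.+1) \sum_(k < n.+1 | (k <= n - j)%N) c j k).
  apply: eq_bigr => /= j _; transitivity (a j *: cauchy *:%R b u (n - j)%N) => //.
  rewrite cauchy_rev scaler_sumr (big_ord_narrow_leq (leq_subr _ _)).
  by apply: eq_bigr => k _; rewrite scalerA.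
rewrite (exchange_big_dep predT) //=; apply: eq_bigr => k _.
transitivity (\sum_(j < n.+1 | (j <= n - k)%N) c j k).
  apply: eq_bigl => j; rewrite -ltnS -(ltnS j) -!subSn ?leq_ord //.
  by rewrite -subn_gt0 -(subn_gt0 j) -!subnDA addnC.
rewrite (big_ord_narrow_leq (leq_subr _ _)) scaler_suml.
by apply: eq_bigr => j _; rewrite /c -!subnDA addnC.
Qed.

Fact fps_scale1 : left_id fps_one fps_scale.
Proof.
move=> u; apply: fpsP => n /=.
by rewrite big_ord_recl big1 ?scale1r ?addr0 ?subn0 // => i _; rewrite scale0r.
Qed.

Fact fps_scaleDr : right_distributive fps_scale +%R.
Proof.
move=> a u v; apply: fpsP => n /=; rewrite -big_split.
by apply: eq_bigr => i _; rewrite scalerDr.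
Qed.

Fact fps_scaleDl u : {morph fps_scale^~ u : a b / a + b}.
Proof.
move=> a b; apply: fpsP => n /=; rewrite -big_split.
by apply: eq_bigr => i _; rewrite scalerDl.
Qed.

End FpsScale.

Section FpsRing.
Variable R : comNzRingType.
Implicit Types a b c : fps R.

Fact fps_mulA : associative (@fps_mul R).
Proof. exact: (@fps_scaleA R R^o). Qed.

Fact fps_mulC : commutative (@fps_mul R).
Proof.
move=> a b; apply: fpsP => n; rewrite cauchy_rev /=.
by apply: eq_bigr => i _; rewrite mulrC.
Qed.

Fact fps_mul1 : left_id (fps_one R) (@fps_mul R).
Proof. exact: (@fps_scale1 R R^o). Qed.

Fact fps_mulDl : left_distributive (@fps_mul R) +%R.
Proof. by move=> a b c; exact: (@fps_scaleDl R R^o). Qed.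

Fact fps_one_neq0 : fps_one R != 0.
Proof.
by apply/eqP => /(congr1 (fun u : fps R => u 0%N))/eqP; rewrite oner_eq0.
Qed.

HB.instance Definition _ := GRing.Zmodule_isComNzRing.Build (fps R)
  fps_mulA fps_mulC fps_mul1 fps_mulDl fps_one_neq0.

End FpsRing.

HB.instance Definition _ (R : comNzRingType) (M : lmodType R) :=
  GRing.Zmodule_isLmodule.Build (fps R) (fps M)
    (@fps_scaleA R M) (@fps_scale1 R M) (@fps_scaleDr R M) (@fps_scaleDl R M).

(* Hom(/\^3 L, L), as the skew-symmetric maps in the space of curried        *)
(* trilinear maps.                                                           *)

Notation trihom L := 'Hom(L, 'Hom(L, 'Hom(L, L))).

Section Alt3.
Variables (F : fieldType) (L : vectType F).

Definition skew_trihom : {pred trihom L} :=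
  fun f => `[< skew_symmetric (fun x y z => f x y z) >].

Fact skew_trihom_closed : submod_closed skew_trihom.
Proof.
split=> [|a f g /asboolP[f1 f2] /asboolP[g1 g2]]; apply/asboolP.
  by split=> x y z; rewrite !zero_lfunE oppr0.
by split=> x y z; rewrite !(add_lfunE, scale_lfunE);
  [rewrite f1 g1 | rewrite f2 g2]; rewrite scalerN opprD.
Qed.
HB.instance Definition _ :=
  GRing.isSubmodClosed.Build F (trihom L) skew_trihom skew_trihom_closed.

Record alt3 := Alt3 { trihom_of :> trihom L; _ : trihom_of \in skew_trihom }.
HB.instance Definition _ := [isSub for trihom_of].
HB.instance Definition _ := [Choice of alt3 by <:].
HB.instance Definition _ := [SubChoice_isSubLmodule of alt3 by <:].

Lemma alt3_skew (f : alt3) : skew_symmetric (fun x y z => f x y z).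
Proof. by case: f => f /= /asboolP. Qed.

Lemma alt3_linE (a : F) (f g : alt3) x y z :
  (a *: f + g) x y z = a *: f x y z + g x y z.
Proof.
have -> : trihom_of (a *: f + g) = a *: trihom_of f + trihom_of g.
  exact: (linearP (val : alt3 -> trihom L)).
by rewrite !(add_lfunE, scale_lfunE).
Qed.

Lemma alt3D1 (f : alt3) u v y z : f (u + v) y z = f u y z + f v y z.
Proof. by rewrite linearD !add_lfunE. Qed.
Lemma alt3D2 (f : alt3) x u v z : f x (u + v) z = f x u z + f x v z.
Proof. by rewrite linearD !add_lfunE. Qed.
Lemma alt3D3 (f : alt3) x y u v : f x y (u + v) = f x y u + f x y v.
Proof. by rewrite linearD. Qed.
Lemma alt3N1 (f : alt3) u y z : f (- u) y z = - f u y z.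
Proof. by rewrite linearN !opp_lfunE. Qed.
Lemma alt3N2 (f : alt3) x u z : f x (- u) z = - f x u z.
Proof. by rewrite linearN !opp_lfunE. Qed.
Lemma alt3N3 (f : alt3) x y u : f x y (- u) = - f x y u.
Proof. by rewrite linearN. Qed.
Lemma alt3Z1 (f : alt3) a u y z : f (a *: u) y z = a *: f u y z.
Proof. by rewrite linearZ !scale_lfunE. Qed.
Lemma alt3Z2 (f : alt3) a x u z : f x (a *: u) z = a *: f x u z.
Proof. by rewrite linearZ !scale_lfunE. Qed.
Lemma alt3Z3 (f : alt3) a x y u : f x y (a *: u) = a *: f x y u.
Proof. by rewrite linearZ. Qed.
Definition alt3E := (alt3D1, alt3D2, alt3D3, alt3N1, alt3N2, alt3N3,
  alt3Z1, alt3Z2, alt3Z3).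

(* The curried linear map given by a trilinear function (junk otherwise). *)
Definition trihom_fun (f : L -> L -> L -> L) : trihom L :=
  linfun (fun x => linfun (fun y => linfun (fun z => f x y z))).

Lemma linear_lfunE (U V : vectType F) (f : U -> V) :
  linear f -> linfun f =1 f.
Proof.
move=> fl; pose m := GRing.isLinear.Build F U V *:%R f fl.
pose ff : {linear U -> V} := HB.pack f m.
exact: (lfunE ff).
Qed.

Lemma trihom_funE f : trilinear f ->
  forall x y z, trihom_fun f x y z = f x y z.
Proof.
case=> f1 f2 f3.
have E2 x y z : linfun (fun y => linfun (fun z => f x y z)) y z = f x y z.
  have l2 : linear (fun y => linfun (fun z => f x y z)).
    move=> a u v; apply/lfunP => w.
    rewrite add_lfunE scale_lfunE !linear_lfunE //; exact: f2.
  by rewrite (linear_lfunE l2) linear_lfunE.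
have l1 : linear (fun x => linfun (fun y => linfun (fun z => f x y z))).
  move=> a u v; apply/lfunP => y; apply/lfunP => z.
  by rewrite !(add_lfunE, scale_lfunE) !E2 f1.
by move=> x y z; rewrite /trihom_fun (linear_lfunE l1) E2.
Qed.

End Alt3.

Section Cohomology.
Variables (F : fieldType) (L : vectType F) (br : alt3 L) (theta : 'End(L)).
Implicit Types (alpha g : 'End(L)) (f : alt3 L).

Definition C1 := 'End(L).
Definition C2 : Type := (alt3 L * 'End(L))%type.
HB.instance Definition _ := GRing.Lmodule.on C2.

Definition d1_fun alpha x y z : L :=
  - alpha (br x y z) + br x y (alpha z) + br (alpha x) y z + br x (alpha y) z.

Fact d1_trilinear alpha : trilinear (d1_fun alpha).
Proof.
have AC4 (a : F) (A B C D A' B' C' D' : L) :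
    (a *: - A + - A') + (a *: B + B') + (a *: C + C') + (a *: D + D') =
    a *: (- A + B + C + D) + (- A' + B' + C' + D').
  rewrite !scalerDr.
  by rewrite (addrACA (a *: - A)) (addrACA (a *: - A + _))
    (addrACA (a *: - A + _ + _)).
by split=> [y z|x z|x y] a u v; rewrite /d1_fun
  !(linearP, add_lfunE, scale_lfunE); exact: AC4.
Qed.

Fact d1_skew alpha :
  trihom_fun (d1_fun alpha) \in @skew_trihom F L.
Proof.
have [/= b1 b2] := alt3_skew br.
apply/asboolP; split=> x y z; rewrite !(trihom_funE (d1_trilinear alpha)) /d1_fun.
  rewrite (b1 x y z) (b1 x y (alpha z)) (b1 x (alpha y)) (b1 (alpha x) y).
  by rewrite linearN !opprD addrAC.
rewrite (b2 x y z) (b2 x y (alpha z)) (b2 (alpha x)) (b2 x (alpha y)).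
by rewrite linearN !opprD [LHS]addrAC [X in X + _ = _]addrAC [LHS]addrAC.
Qed.

Definition d1 alpha : alt3 L := Alt3 (d1_skew alpha).

Lemma d1E alpha x y z : d1 alpha x y z =
  - alpha (br x y z) + br x y (alpha z) + br (alpha x) y z + br x (alpha y) z.
Proof. exact: (trihom_funE (d1_trilinear alpha)). Qed.

Definition delta1 alpha : 'End(L) := ((alpha \o theta) - (theta \o alpha))%VF.

Lemma delta1E alpha z : delta1 alpha z = alpha (theta z) - theta (alpha z).
Proof. by rewrite add_lfunE opp_lfunE !comp_lfunE. Qed.

Definition partial1 (alpha : C1) : C2 := (d1 alpha, - delta1 alpha).

Definition d2 f x1 x2 x3 x4 x5 : L :=
  - f (br x1 x2 x3) x4 x5 - f x3 (br x1 x2 x4) x5 - f x3 x4 (br x1 x2 x5)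
  + f x1 x2 (br x3 x4 x5) + br x1 x2 (f x3 x4 x5) - br x3 x4 (f x1 x2 x5)
  - br (f x1 x2 x3) x4 x5 - br x3 (f x1 x2 x4) x5.

Definition delta2 f x y z : L :=
  f (theta x) y z + f x (theta y) z + f x y (theta z) - theta (f x y z).

(* ker (partial : C^2 -> C^3), where partial (f, g) = (d f, d g + delta f). *)
Definition is_cocycle : {pred C2} := fun c =>
  `[< (forall x1 x2 x3 x4 x5, d2 c.1 x1 x2 x3 x4 x5 = 0) /\
      (forall x y z, d1 c.2 x y z + delta2 c.1 x y z = 0) >].

(* Vector identities are checked on coordinates, where ring applies. *)
Definition coordinate i (u : L) : F := coord (vbasis {:L}) i u.

Fact coordinate_inj u v : (forall i, coordinate i u = coordinate i v) -> u = v.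
Proof.
move=> uv; rewrite (coord_vbasis (memvf u)) (coord_vbasis (memvf v)).
by apply: eq_bigr => i _; rewrite [X in X *: _](uv i).
Qed.

Fact coordinateD i u v : coordinate i (u + v) = coordinate i u + coordinate i v.
Proof. exact: linearD. Qed.

Fact coordinateN i u : coordinate i (- u) = - coordinate i u.
Proof. exact: linearN. Qed.

Fact coordinateZ i a u : coordinate i (a *: u) = a * coordinate i u.
Proof. exact: linearZ. Qed.

Definition coordinateE := (coordinateD, coordinateN, coordinateZ).

Fact d2_lin (a : F) (f g : alt3 L) x1 x2 x3 x4 x5 :
  d2 (a *: f + g) x1 x2 x3 x4 x5 =
  a *: d2 f x1 x2 x3 x4 x5 + d2 g x1 x2 x3 x4 x5.
Proof.
rewrite /d2 !alt3_linE !alt3E.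
apply: coordinate_inj => i.
by rewrite !coordinateE /=; ring.
Qed.

Fact d1_lin (a : F) (g h : 'End(L)) x y z :
  d1 (a *: g + h) x y z = a *: d1 g x y z + d1 h x y z.
Proof.
rewrite !d1E !(add_lfunE, scale_lfunE) !(linearP, add_lfunE, scale_lfunE) /=.
apply: coordinate_inj => i.
by rewrite !coordinateE /=; ring.
Qed.

Fact delta2_lin (a : F) (f g : alt3 L) x y z :
  delta2 (a *: f + g) x y z = a *: delta2 f x y z + delta2 g x y z.
Proof.
rewrite /delta2 !alt3_linE !linearP /=; apply: coordinate_inj => i.
by rewrite !coordinateE /=; ring.
Qed.

Fact is_cocycle_closed : submod_closed is_cocycle.
Proof.
have H (a : F) (c e : C2) : c \in is_cocycle -> e \in is_cocycle ->
    a *: c + e \in is_cocycle.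
  move=> /asboolP[c1 c2] /asboolP[e1 e2]; apply/asboolP; split=> /=.
    by move=> x1 x2 x3 x4 x5; rewrite d2_lin c1 e1 scaler0 addr0.
  move=> x y z; rewrite d1_lin delta2_lin addrACA -scalerDr.
  by rewrite c2 e2 scaler0 addr0.
split=> //; apply/asboolP; split=> /=.
  move=> x1 x2 x3 x4 x5; have := d2_lin (-1) 0 0 x1 x2 x3 x4 x5.
  by rewrite scaler0 addr0 scaleN1r addNr.
move=> x y z; have := d1_lin (-1) 0 0 x y z; have := delta2_lin (-1) 0 0 x y z.
by rewrite !scaler0 !addr0 !scaleN1r !addNr => -> ->; rewrite addr0.
Qed.
HB.instance Definition _ :=
  GRing.isSubmodClosed.Build F C2 is_cocycle is_cocycle_closed.

Record Z2 := Cocycle { cochain_of :> C2; _ : cochain_of \in is_cocycle }.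
HB.instance Definition _ := [isSub for cochain_of].
HB.instance Definition _ := [Choice of Z2 by <:].
HB.instance Definition _ := [SubChoice_isSubLmodule of Z2 by <:].

(* By partial1_cocycle below, this is the whole image of partial1. *)
Definition is_coboundary : {pred Z2} :=
  fun c => `[< exists alpha : C1, partial1 alpha = c >].

Fact partial1_zmod alpha beta :
  partial1 (alpha - beta) = partial1 alpha - partial1 beta.
Proof.
congr (_, _).
  apply: val_inj; apply/lfunP => x; apply/lfunP => y; apply/lfunP => z.
  rewrite -[alpha - beta]addrC -scaleN1r d1_lin -scaleN1r addrC.
  by rewrite addrC -alt3_linE addrC.
apply/lfunP => x; apply: coordinate_inj => i.
rewrite !(opp_lfunE, add_lfunE, comp_lfunE) linearB /=.
by rewrite !coordinateE; ring.
Qed.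

Fact is_coboundary_closed : zmod_closed is_coboundary.
Proof.
split=> [|c e /asboolP[a ca] /asboolP[b eb]]; apply/asboolP.
  by exists 0; rewrite -[X in partial1 X](subrr 0) partial1_zmod subrr.
by exists (a - b); rewrite partial1_zmod ca eb.
Qed.
HB.instance Definition _ :=
  GRing.isZmodClosed.Build Z2 is_coboundary is_coboundary_closed.

Definition H2 := Quotient.quot is_coboundary.

Fact partial1_cocycle alpha :
  is_3LieDer (fun x y z => br x y z) theta -> partial1 alpha \in is_cocycle.
Proof.
move=> [[_ [/= s1 s2] fi] [_ /= der]].
have aD u v : alpha (u + v) = alpha u + alpha v by exact: linearD.
have aN u : alpha (- u) = - alpha u by exact: linearN.
apply/asboolP; split=> /=.
  move=> x1 x2 x3 x4 x5; rewrite /d2 !d1E.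
  rewrite !(alt3E, aD, aN).
  rewrite (fi x1 x2 x3 x4 x5) (fi (alpha x1)) (fi x1 (alpha x2)).
  rewrite (fi x1 x2 (alpha x3)) (fi x1 x2 x3 (alpha x4)).
  rewrite (fi x1 x2 x3 x4 (alpha x5)) !aD.
  apply: coordinate_inj => i.
  by rewrite !coordinateE /=; ring.
move=> x y z; rewrite /delta2 !d1E.
have dN u : (- delta1 alpha) u = theta (alpha u) - alpha (theta u).
  by rewrite opp_lfunE delta1E opprB.
have tD u v : theta (u + v) = theta u + theta v by exact: linearD.
have tN u : theta (- u) = - theta u by exact: linearN.
rewrite !dN !(alt3E, tD, tN) !der !aD.
apply: coordinate_inj => i.
by rewrite !coordinateE (_ : coordinate i 0 = 0) ?[coordinate i 0]linear0 //; ring.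
Qed.

End Cohomology.

Section Deformations.
Variables (F : fieldType) (L : vectType F).
Implicit Types (f : fps (alt3 L)) (g : fps 'End(L)).

(* (sum_i h_i t^i)(sum_j u_j t^j) = sum_n (sum_(i + j = n) h_i(u_j)) t^n *)
Definition fps_app (U V : vectType F) (h : fps 'Hom(U, V)) (u : fps U) : fps V :=
  cauchy (fun (phi : 'Hom(U, V)) x => phi x) h u.

(* The F[[t]]-trilinear extension of f_t to L[[t]]:                          *)
(* f_t(x, y, z) = sum_n (sum_(i + j + k + l = n) f_i(x_j, y_k, z_l)) t^n     *)
Definition fps_app3 f (x y z : fps L) : fps L :=
  fps_app (fps_app (fps_app (Fps (fun n => trihom_of (f n))) x) y) z.

Definition is_deformation (br : alt3 L) (theta : 'End(L)) f g : Prop :=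
  [/\ f 0%N = br, g 0%N = theta
    & @is_3LieDer (fps F) (fps L) (fps_app3 f) (fps_app g)].

Definition equivalent_deformations f g f' g' : Prop :=
  exists Phi : fps 'End(L),
    [/\ Phi 0%N = \1%VF,
        forall x y z, fps_app Phi (fps_app3 f' x y z) =
          fps_app3 f (fps_app Phi x) (fps_app Phi y) (fps_app Phi z)
      & forall x, fps_app Phi (fps_app g' x) = fps_app g (fps_app Phi x)].

End Deformations.

(* Main.v *)
Require Import Defs.
From mathcomp Require Import all_boot all_order all_algebra.
From mathcomp Require Import boolp ring.

Set Implicit Arguments.
Unset Strict Implicit.
Unset Printing Implicit Defensive.

Import GRing.Theory.
Local Open Scope ring_scope.
Local Open Scope quotient_scope.

(** The equivalence Phi need not be trivial below order n: its coefficients phi_i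
    with 0 < i < n may be nonzero, and then the coefficient of t^n in
    f_t(Phi x, Phi y, Phi z) contains cross terms such as [phi_j x, phi_k y, z].
    Hence f'_n - f_n is not simply d(phi_n); one must show that the cross terms
    form a coboundary as well, and this is where characteristic 0 enters.

    The remedy is to differentiate. Write D = t d/dt, and let E = (D Phi) o Phi^-1
    be the logarithmic derivative of Phi, so that D Phi = E o Phi and E_0 = 0
    (log_derivative). By the assumption on the coefficients below n,
      [Phi x, Phi y, Phi z] - Phi [x, y, z] = (f'_n - f_n)(x, y, z) t^n + O(t^(n+1))
    for x, y, z in L. Apply D - E to this series H. On the right the leading
    coefficient is multiplied by n, since E has no constant term. On the left,
    D is a derivation and D Phi = E o Phi, so that the terms with Phi [x, y, z]
    cancel and what remains is (d E)(Phi x, Phi y, Phi z), where d E is the series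
    with coefficients d(E_m). As Phi = id + O(t), the substitution of Phi does not
    change leading terms (leads_untwist), so d(E_n) = n (f'_n - f_n): all the cross
    terms have been absorbed in E_n (d1_log_derivative). The same argument with
    theta in place of the bracket gives delta(E_n) = n (g_n - g'_n)
    (delta1_log_derivative). Dividing by n, the difference of the two
    infinitesimals is the coboundary of E_n / n.

    That the infinitesimals are cocycles is the coefficient of t^n in the
    identities defining a 3-LieDer pair, evaluated at constant series
    (infinitesimal_cocycle). *)

(** * Convolution sums *)

(** The coefficient of a product of two series, with an arbitrary summand, so that
    reassociating products of different kinds only needs convA and convCA. *)
Definition conv (W : zmodType) (G : nat -> nat -> W) (n : nat) : W :=
  \sum_(i < n.+1) G i (n - i)%N.

Section Convolution.
Variable W : zmodType.
Implicit Types G : nat -> nat -> W.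

Lemma eq_conv G1 G2 n : G1 =2 G2 -> conv G1 n = conv G2 n.
Proof. by move=> eqG; apply: eq_bigr => i _; apply: eqG. Qed.

Lemma convC G n : conv G n = conv (fun i j => G j i) n.
Proof.
rewrite /conv (reindex_inj rev_ord_inj); apply: eq_bigr => i _ /=.
by rewrite subSS subKn ?leq_ord.
Qed.

Lemma convB G1 G2 n : conv (fun i j => G1 i j - G2 i j) n = conv G1 n - conv G2 n.
Proof. by rewrite /conv sumrB. Qed.

Lemma convD G1 G2 n : conv (fun i j => G1 i j + G2 i j) n = conv G1 n + conv G2 n.
Proof. by rewrite /conv big_split. Qed.

(** Both sides sum G i j k over i + j + k = n: once k is determined by i and j,
    exchange the order of summation over the triangle i + j <= n. *)
Lemma convCA (G : nat -> nat -> nat -> W) n :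
  conv (fun j p => conv (fun i k => G i j k) p) n =
  conv (fun i q => conv (fun j k => G i j k) q) n.
Proof.
rewrite /conv.
transitivity (\sum_(j < n.+1) \sum_(i < n.+1 | (i <= n - j)%N) G i j (n - j - i)%N).
  by apply: eq_bigr => j _; rewrite (big_ord_narrow_leq (leq_subr _ _)).
rewrite (exchange_big_dep predT) //=; apply: eq_bigr => i _.
transitivity (\sum_(j < n.+1 | (j <= n - i)%N) G i j (n - j - i)%N).
  apply: eq_bigl => j; rewrite -ltnS -(ltnS j) -!subSn ?leq_ord //.
  by rewrite -subn_gt0 -(subn_gt0 j) -!subnDA addnC.
rewrite (big_ord_narrow_leq (leq_subr _ _)).
by apply: eq_bigr => j _; rewrite -!subnDA addnC.
Qed.

Lemma convA (G : nat -> nat -> nat -> W) n :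
  conv (fun p k => conv (fun i j => G i j k) p) n =
  conv (fun i q => conv (fun j k => G i j k) q) n.
Proof.
rewrite convC (convCA (fun i k j => G i j k)).
by apply: eq_bigr => i _; rewrite convC.
Qed.

Lemma conv_low m G :
  (forall i j, (i < m)%N -> G i j = 0) ->
  (forall i, (i < m)%N -> conv G i = 0) /\ conv G m = G m 0%N.
Proof.
move=> G0; split=> [i im|].
  by rewrite /conv big1 // => j _; apply: G0; apply: leq_ltn_trans im; rewrite -ltnS.
by rewrite /conv big_ord_recr /= subnn big1 ?add0r // => j _; apply: G0.
Qed.

End Convolution.

Lemma conv_linear (F : fieldType) (U V : vectType F) (h : 'Hom(U, V)) G n :
  h (conv G n) = conv (fun i j => h (G i j)) n.
Proof. exact: linear_sum. Qed.

(** * Series and their leading terms *)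

Section Series.
Variables (V : zmodType).
Implicit Types (u v : fps V) (a b : V).

Definition fps_const a : fps V := Fps (fun n => if n == 0%N then a else 0).

Lemma fps_addE u v n : (u + v) n = u n + v n.
Proof. by []. Qed.

Lemma fps_subE u v n : (u - v) n = u n - v n.
Proof. by []. Qed.

(** The Euler operator t d/dt. *)
Definition euler u : fps V := Fps (fun n => u n *+ n).

Lemma eulerB u v : euler (u - v) = euler u - euler v.
Proof. by apply: fpsP => n; rewrite /= mulrnBl. Qed.

Lemma euler_const a : euler (fps_const a) = 0.
Proof. by apply: fpsP => -[|n] /=; rewrite ?mul0rn. Qed.

(** The leading-term relation u = a t^n + O(t^(n+1)), with a = 0 allowed. *)
Definition leads n u a := (forall i, (i < n)%N -> u i = 0) /\ u n = a.

Lemma leadsB n u v a b : leads n u a -> leads n v b -> leads n (u - v) (a - b).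
Proof.
by move=> [u0 un] [v0 vn]; split=> [i lin|] /=; rewrite ?un ?vn // u0 ?v0 // subr0.
Qed.

Lemma leads_euler n u a : leads n u a -> leads n (euler u) (a *+ n).
Proof. by move=> [u0 un]; split=> [i lin|] /=; rewrite ?un // u0 ?mul0rn. Qed.

Lemma leads_tail n u : (0 < n)%N ->
  (forall i, (1 <= i < n)%N -> u i = 0) -> leads n (u - fps_const (u 0%N)) (u n).
Proof.
case: n => // n _ u0; split=> [[|i] lin|] /=; rewrite ?subrr ?subr0 //.
exact: u0.
Qed.

End Series.

(** The values E 0, ..., E (m - 1) are accumulated in the list s m, whose entries
    no longer change once they have been appended. *)
Lemma strong_recursion (T : Type) (x0 : T) (step : nat -> (nat -> T) -> T) :
  (forall m E1 E2, (forall i, (i < m)%N -> E1 i = E2 i) ->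
    step m E1 = step m E2) ->
  exists E : nat -> T, forall m, E m = step m E.
Proof.
move=> step_ext.
pose fix s m := if m is k.+1 then rcons (s k) (step k (nth x0 (s k))) else [::].
have sz m : size (s m) = m by elim: m => //= m IH; rewrite size_rcons IH.
have E m : nth x0 (s m.+1) m = step m (nth x0 (s m)).
  by rewrite /= nth_rcons sz ltnn eqxx.
exists (fun m => nth x0 (s m.+1) m) => m; rewrite E; apply: step_ext => i.
elim: m => // m IH; rewrite ltnS leq_eqVlt => /orP[/eqP -> //|lim].
by rewrite /= nth_rcons sz lim IH.
Qed.

(** * Series of linear maps *)

Section Application.
Variable F : fieldType.

Section OneVariable.
Variables U V : vectType F.
Implicit Types (h k : fps 'Hom(U, V)) (u v : fps U).

Lemma fps_appBl h k u : fps_app (h - k) u = fps_app h u - fps_app k u.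
Proof.
apply: fpsP => n; rewrite /= -sumrB; apply: eq_bigr => i _.
by rewrite add_lfunE opp_lfunE.
Qed.

Lemma fps_appE h u n : fps_app h u n = conv (fun i j => h i (u j)) n.
Proof. by []. Qed.

Lemma fps_appDl h k u : fps_app (h + k) u = fps_app h u + fps_app k u.
Proof.
apply: fpsP => n; rewrite /= -big_split; apply: eq_bigr => i _.
by rewrite add_lfunE.
Qed.

Lemma fps_appBr h u v : fps_app h (u - v) = fps_app h u - fps_app h v.
Proof.
by apply: fpsP => n; rewrite /= -sumrB; apply: eq_bigr => i _; rewrite linearB.
Qed.

Lemma fps_app_const h x n : fps_app h (fps_const x) n = h n x.
Proof.
rewrite /= big_ord_recr /= subnn big1 ?add0r // => i _.
by rewrite subn_eq0 leqNgt ltn_ord /= linear0.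
Qed.

Lemma fps_const_app (h : 'Hom(U, V)) u n : fps_app (fps_const h) u n = h (u n).
Proof.
rewrite /= big_ord_recl /= subn0 big1 ?addr0 // => i _.
by rewrite zero_lfunE.
Qed.

Lemma muln_lfunE (h : 'Hom(U, V)) m x : (h *+ m) x = h x *+ m.
Proof. by rewrite -!scaler_nat scale_lfunE. Qed.

Lemma euler_app h u :
  euler (fps_app h u) = fps_app (euler h) u + fps_app h (euler u).
Proof.
apply: fpsP => n; rewrite /= -sumrMnl -big_split; apply: eq_bigr => i _ /=.
by rewrite muln_lfunE raddfMn -mulrnDr subnKC // -ltnS.
Qed.

Lemma fps_app0 u : fps_app (0 : fps 'Hom(U, V)) u = 0.
Proof. by rewrite -(subrr 0) fps_appBl subrr. Qed.

Lemma leads_appl n h u a : leads n h a -> leads n (fps_app h u) (a (u 0%N)).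
Proof.
move=> [h0 <-]; have [] // := @conv_low _ n (fun i j => h i (u j)).
by move=> i j lin; rewrite h0 ?zero_lfunE.
Qed.

Lemma leads_appr n h u a : leads n u a -> leads n (fps_app h u) (h 0%N a).
Proof.
move=> [u0 <-]; have := @conv_low _ n (fun i j => h j (u i)).
case=> [i j lin|L0 L1]; first by rewrite u0 ?linear0.
split=> [i lin|]; first by rewrite -(L0 i lin) convC.
by rewrite -L1 convC.
Qed.

Lemma fps_app_gap h u n : (0 < n)%N -> (forall i, (1 <= i < n)%N -> h i = 0) ->
  fps_app h u n = h 0%N (u n) + h n (u 0%N).
Proof.
case: n => // n _ h0; rewrite /= big_ord_recl big_ord_recr /= subn0 subnn.
by rewrite big1 ?add0r // => i _; rewrite h0 ?zero_lfunE //= /bump /= ltnS ltn_ord.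
Qed.

End OneVariable.

(** Since Phi = id + O(t), the lowest nonvanishing coefficient of K o Phi is that of
    K; by induction the coefficients of K below n vanish one after the other. *)
Lemma leads_untwist (L V : vectType F) (K : fps 'Hom(L, V)) (a : 'Hom(L, V))
    (Phi : fps 'End(L)) n :
  Phi 0%N = \1%VF ->
  (forall x, leads n (fps_app K (fps_app Phi (fps_const x))) (a x)) ->
  leads n K a.
Proof.
move=> Phi0 Ka.
have top m : (forall i, (i < m)%N -> K i = 0) ->
    forall x, fps_app K (fps_app Phi (fps_const x)) m = K m x.
  move=> K0 x; have [] // := leads_appl (fps_app Phi (fps_const x)) (conj K0 erefl).
  by move=> _ ->; rewrite fps_app_const Phi0 id_lfunE.
have K0 i : (i < n)%N -> K i = 0.
  elim/ltn_ind: i => i IH lin; apply/lfunP => x; rewrite zero_lfunE -top.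
    by case: (Ka x) => low _; apply: low.
  by move=> j ji; apply: IH => //; apply: ltn_trans lin.
by split=> //; apply/lfunP => x; rewrite -(top n K0); case: (Ka x).
Qed.

End Application.

(** * Series of skew-symmetric trilinear maps *)

Section Trilinear.
Variables (F : fieldType) (L : vectType F).
Implicit Types (f K : fps (alt3 L)) (br : alt3 L) (u v w : fps L).

Lemma alt3P (f1 f2 : alt3 L) : (forall x y z, f1 x y z = f2 x y z) -> f1 = f2.
Proof.
by move=> e; apply: val_inj; apply/lfunP => x; apply/lfunP => y; apply/lfunP.
Qed.

Lemma alt3_0E x y z : (0 : alt3 L) x y z = 0.
Proof. by have := alt3_linE (-1) 0 0 x y z; rewrite scaler0 addr0 scaleN1r addNr. Qed.

Lemma alt3BE (f1 f2 : alt3 L) x y z : (f1 - f2) x y z = f1 x y z - f2 x y z.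
Proof. by rewrite addrC -scaleN1r alt3_linE scaleN1r addrC. Qed.

Lemma alt3_scaleE a (f1 : alt3 L) x y z : (a *: f1) x y z = a *: f1 x y z.
Proof. by have := alt3_linE a f1 0 x y z; rewrite alt3_0E !addr0. Qed.

Lemma alt3_mulrnE (f1 : alt3 L) n x y z : (f1 *+ n) x y z = f1 x y z *+ n.
Proof.
elim: n => [|n IH]; first exact: alt3_0E.
have := alt3_linE 1 f1 (f1 *+ n) x y z; rewrite !scale1r -!mulrS => ->.
by rewrite IH mulrS.
Qed.

Lemma fps_app3B f K u v w :
  fps_app3 (f - K) u v w = fps_app3 f u v w - fps_app3 K u v w.
Proof. by rewrite /fps_app3 -!fps_appBl. Qed.

(** The index of K is summed outermost: fps_app3_d1 brings all its terms to this
    form, where they can be compared summand by summand. *)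
Lemma fps_app3E K u v w n : fps_app3 K u v w n =
  conv (fun i r => conv (fun q l => conv (fun j k =>
    K i (u j) (v k) (w l)) q) r) n.
Proof.
rewrite -(convA (fun i q l => conv (fun j k => K i (u j) (v k) (w l)) q)).
rewrite [LHS]fps_appE; apply: eq_conv => a l.
rewrite -(convA (fun i j k => K i (u j) (v k) (w l))) fps_appE sum_lfunE.
by apply: eq_bigr => b _; rewrite fps_appE !sum_lfunE.
Qed.

Lemma fps_app3_constl br u v w n : fps_app3 (fps_const br) u v w n =
  conv (fun q l => conv (fun j k => br (u j) (v k) (w l)) q) n.
Proof.
rewrite fps_app3E {1}/conv big_ord_recl /= subn0 big1 ?addr0 // => i _.
by rewrite /conv !big1 // => j _; rewrite big1 // => k _; rewrite alt3_0E.
Qed.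

Lemma fps_app3_const f x y z n :
  fps_app3 f (fps_const x) (fps_const y) (fps_const z) n = f n x y z.
Proof. by rewrite /fps_app3 !fps_app_const. Qed.

Lemma fps_const_app3_const br x y z :
  fps_app3 (fps_const br) (fps_const x) (fps_const y) (fps_const z) =
  fps_const (br x y z).
Proof.
by apply: fpsP => n; rewrite fps_app3_const /=; case: n => //=; rewrite alt3_0E.
Qed.

Lemma leads_app3 n K (a : alt3 L) u v w : leads n K a ->
  leads n (fps_app3 K u v w) (a (u 0%N) (v 0%N) (w 0%N)).
Proof.
move=> [K0 Kn]; do 3!apply: leads_appl; split=> [i lin|] /=; last by rewrite Kn.
by rewrite K0.
Qed.

Lemma leads_untwist3 K (a : alt3 L) (Phi : fps 'End(L)) n :
  Phi 0%N = \1%VF ->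
  (forall x y z, leads n (fps_app3 K (fps_app Phi (fps_const x))
    (fps_app Phi (fps_const y)) (fps_app Phi (fps_const z))) (a x y z)) ->
  leads n K a.
Proof.
move=> Phi0 Ka.
(* Currying turns the claim into three uses of the one-variable case. *)
have [K0 Kn] : leads n (Fps (fun i => trihom_of (K i))) (trihom_of a).
  by do 3!apply: (leads_untwist Phi0) => ?; apply: Ka.
by split=> [i lin|]; [apply: val_inj; apply: K0 | apply: val_inj].
Qed.

Lemma euler_app3 br u v w : euler (fps_app3 (fps_const br) u v w) =
  fps_app3 (fps_const br) (euler u) v w + fps_app3 (fps_const br) u (euler v) w
  + fps_app3 (fps_const br) u v (euler w).
Proof.
have e0 : euler (Fps (fun n => trihom_of (fps_const br n))) = 0.
  by apply: fpsP => -[|n] //=; exact: mul0rn.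
by rewrite /fps_app3 !euler_app e0 fps_app0 add0r fps_appDl.
Qed.

(** The coboundary d alpha measures how far alpha is from being a derivation of the
    bracket. This extends coefficientwise to the series E, acting on L[[t]] with
    the t-linearly extended bracket. *)
Lemma fps_app3_d1 br (E : fps 'End(L)) u v w :
  fps_app3 (Fps (fun n => d1 br (E n))) u v w =
  fps_app3 (fps_const br) (fps_app E u) v w
  + fps_app3 (fps_const br) u (fps_app E v) w
  + fps_app3 (fps_const br) u v (fps_app E w)
  - fps_app E (fps_app3 (fps_const br) u v w).
Proof.
have outE n : fps_app E (fps_app3 (fps_const br) u v w) n =
    conv (fun i r => conv (fun q l => conv (fun j k => E i (br (u j) (v k) (w l))) q) r) n.
  rewrite fps_appE; apply: eq_conv => i r; rewrite fps_app3_constl conv_linear.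
  by apply: eq_conv => q l; rewrite conv_linear.
have in1E n : fps_app3 (fps_const br) (fps_app E u) v w n =
    conv (fun i r => conv (fun q l => conv (fun j k => br (E i (u j)) (v k) (w l)) q) r) n.
  rewrite -(convA (fun i q l => conv (fun j k => br (E i (u j)) (v k) (w l)) q)).
  rewrite fps_app3_constl; apply: eq_conv => a l.
  rewrite -(convA (fun i j k => br (E i (u j)) (v k) (w l))).
  by apply: eq_conv => p k; rewrite /= linear_sum !sum_lfunE; apply: eq_bigr => i _.
have in2E n : fps_app3 (fps_const br) u (fps_app E v) w n =
    conv (fun i r => conv (fun q l => conv (fun j k => br (u j) (E i (v k)) (w l)) q) r) n.
  rewrite -(convA (fun i q l => conv (fun j k => br (u j) (E i (v k)) (w l)) q)).
  rewrite fps_app3_constl; apply: eq_conv => a l.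
  rewrite -(convCA (fun i j k => br (u j) (E i (v k)) (w l))).
  by apply: eq_conv => j p; rewrite /= linear_sum sum_lfunE.
have in3E n : fps_app3 (fps_const br) u v (fps_app E w) n =
    conv (fun i r => conv (fun q l => conv (fun j k => br (u j) (v k) (E i (w l))) q) r) n.
  rewrite -(convCA (fun i q l => conv (fun j k => br (u j) (v k) (E i (w l))) q)).
  rewrite fps_app3_constl; apply: eq_conv => q p.
  rewrite /conv exchange_big; apply: eq_bigr => j _ /=.
  by rewrite linear_sum.
apply: fpsP => n; rewrite fps_subE !fps_addE fps_app3E outE in1E in2E in3E.
rewrite -!convD -convB; apply: eq_conv => i r; rewrite -!convD -convB.
apply: eq_conv => q l; rewrite -!convD -convB; apply: eq_conv => j k.
by rewrite d1E -!addrA addrC !addrA; congr (_ - _); rewrite -addrA addrC.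
Qed.

End Trilinear.

(** * Infinitesimals of deformations *)

Section Deformations.
Variables (F : fieldType) (L : vectType F) (br : alt3 L) (theta : 'End(L)).
Implicit Types (f : fps (alt3 L)) (g Phi : fps 'End(L)).

(** With f = f_0 + f_n t^n + O(t^(n+1)), only two terms of the coefficient of t^n
    survive when all the arguments but one are constant. *)
Section Gap.
Variables (f : fps (alt3 L)) (n : nat).
Hypotheses (n_gt0 : (0 < n)%N) (f_gap : forall i, (1 <= i < n)%N -> f i = 0).

Lemma fps_app3_gap1 u y z : fps_app3 f u (fps_const y) (fps_const z) n =
  f 0%N (u n) y z + f n (u 0%N) y z.
Proof.
rewrite /fps_app3 !fps_app_const fps_app_gap // => [|i lin].
  by rewrite !add_lfunE.
by rewrite /= f_gap.
Qed.

Lemma fps_app3_gap2 x u z : fps_app3 f (fps_const x) u (fps_const z) n =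
  f 0%N x (u n) z + f n x (u 0%N) z.
Proof.
rewrite /fps_app3 fps_app_const fps_app_gap // => [|i lin].
  by rewrite add_lfunE !fps_app_const.
by rewrite fps_app_const /= f_gap // zero_lfunE.
Qed.

Lemma fps_app3_gap3 x y u : fps_app3 f (fps_const x) (fps_const y) u n =
  f 0%N x y (u n) + f n x y (u 0%N).
Proof.
rewrite /fps_app3 fps_app_gap // => [|i lin]; first by rewrite !fps_app_const.
by rewrite !fps_app_const /= f_gap // !zero_lfunE.
Qed.

End Gap.

(** Modulo t^(n+1) the structure is (br + f_n t^n, theta + g_n t^n); the coefficient
    of t^n in the fundamental identity and in the derivation rule is linear in
    (f_n, g_n), and it is the cocycle condition. *)
Lemma infinitesimal_cocycle f g n : is_deformation br theta f g -> (0 < n)%N ->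
  (forall i, (1 <= i < n)%N -> f i = 0 /\ g i = 0) ->
  (f n, g n) \in is_cocycle br theta.
Proof.
move=> [f0 g0 [[_ _ fi] [_ der]]] n0 gap.
have fgap i : (1 <= i < n)%N -> f i = 0 by move=> /gap[].
have ggap i : (1 <= i < n)%N -> g i = 0 by move=> /gap[].
have coef (u a b c : fps L) : u = a + b + c -> u n = a n + b n + c n by move->.
have dF x1 x2 x3 x4 x5 : d2 br (f n) x1 x2 x3 x4 x5 = 0.
  have := coef _ _ _ _ (fi (fps_const x1) (fps_const x2)
    (fps_const x3) (fps_const x4) (fps_const x5)).
  rewrite (fps_app3_gap1 n0 fgap (fps_app3 _ _ _ _)).
  rewrite (fps_app3_gap2 n0 fgap _ (fps_app3 _ _ _ _)).
  rewrite !(fps_app3_gap3 n0 fgap _ _ (fps_app3 _ _ _ _)).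
  rewrite !fps_app3_const f0 => /eqP; rewrite -subr_eq0 => /eqP e.
  rewrite -[RHS]e /d2; apply: coordinate_inj => i.
  by rewrite !coordinateE; ring.
have dG x y z : d1 br (g n) x y z + delta2 theta (f n) x y z = 0.
  have := coef _ _ _ _ (der (fps_const x) (fps_const y) (fps_const z)).
  rewrite (fps_app3_gap1 n0 fgap (fps_app _ _)).
  rewrite (fps_app3_gap2 n0 fgap _ (fps_app _ _)).
  rewrite (fps_app3_gap3 n0 fgap _ _ (fps_app _ _)).
  rewrite (fps_app_gap (fps_app3 _ _ _ _) n0 ggap) !fps_app3_const !fps_app_const.
  rewrite f0 g0.
  move=> /esym/eqP; rewrite -subr_eq0 => /eqP e.
  rewrite -[RHS]e d1E /delta2; apply: coordinate_inj => i.
  by rewrite !coordinateE; ring.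
by apply/asboolP.
Qed.

(** E is (t d/dt Phi) o Phi^-1. Comparing coefficients of t^m in D Phi = E o Phi
    determines E_m from E_0, ..., E_(m-1), because Phi_0 = id, so the inverse
    series is never formed. *)
Lemma log_derivative Phi : Phi 0%N = \1%VF ->
  exists2 E : fps 'End(L), E 0%N = 0 & forall x,
    euler (fps_app Phi (fps_const x)) = fps_app E (fps_app Phi (fps_const x)).
Proof.
move=> Phi0.
pose step m (E : nat -> 'End(L)) : 'End(L) :=
  Phi m *+ m - \sum_(i < m) (E i \o Phi (m - i)%N)%VF.
have [|E EE] := strong_recursion 0 (step := step).
  by move=> m E1 E2 e; congr (_ - _); apply: eq_bigr => i _; rewrite e.
exists (Fps E) => [|x]; first by rewrite /= EE /step big_ord0 subr0.
apply: fpsP => m; transitivity ((Phi m *+ m) x).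
  by rewrite muln_lfunE -fps_app_const.
have -> : Phi m *+ m = \sum_(i < m) (E i \o Phi (m - i)%N)%VF + E m.
  by rewrite EE addrC subrK.
rewrite fps_appE /conv big_ord_recr subnn fps_app_const Phi0 id_lfunE.
rewrite add_lfunE sum_lfunE; congr (_ + _); apply: eq_bigr => i _.
by rewrite comp_lfunE fps_app_const.
Qed.

Lemma fps_app_delta1 (E : fps 'End(L)) u :
  fps_app (Fps (fun n => delta1 theta (E n))) u =
  fps_app E (fps_app (fps_const theta) u) - fps_app (fps_const theta) (fps_app E u).
Proof.
apply: fpsP => n; rewrite fps_subE fps_const_app !fps_appE conv_linear -convB.
by apply: eq_conv => i j; rewrite fps_const_app -delta1E.
Qed.

Lemma partial1Z a alpha :
  partial1 br theta (a *: alpha) = a *: partial1 br theta alpha.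
Proof.
congr (_, _).
  apply: alt3P => x y z; rewrite alt3_scaleE !d1E !scale_lfunE !alt3E.
  by rewrite !scalerDr scalerN.
apply/lfunP => x; rewrite !(opp_lfunE, scale_lfunE) !delta1E !scale_lfunE.
by rewrite linearZ scalerN scalerBr.
Qed.

Section Equivalence.
Variables (f f' : fps (alt3 L)) (g g' Phi E : fps 'End(L)) (n : nat).
Hypotheses (Phi0 : Phi 0%N = \1%VF) (E0 : E 0%N = 0).
Hypothesis EPhi : forall x,
  euler (fps_app Phi (fps_const x)) = fps_app E (fps_app Phi (fps_const x)).
Hypothesis n_gt0 : (0 < n)%N.
Hypotheses (f0 : f 0%N = br) (f'0 : f' 0%N = br).
Hypotheses (g0 : g 0%N = theta) (g'0 : g' 0%N = theta).
Hypothesis fg_gap : forall i, (1 <= i < n)%N -> f i = 0 /\ g i = 0.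
Hypothesis fg_gap' : forall i, (1 <= i < n)%N -> f' i = 0 /\ g' i = 0.

(** E has zero constant term, so it raises the order of a series, and only the Euler
    operator acts on the leading coefficient. *)
Lemma leads_euler_sub u a :
  leads n u a -> leads n (euler u - fps_app E u) (a *+ n).
Proof.
move=> ua; rewrite -[a *+ n]subr0; apply: leadsB; first exact: leads_euler.
by have := leads_appr E ua; rewrite E0 zero_lfunE.
Qed.

(** To order n both deformed brackets differ from br only by their infinitesimals,
    so Phi fails to preserve br by a series with leading term (f'_n - f_n) t^n.
    Taking D - E of this failure turns it into the failure of E to be a derivation
    of br, which is d(E). *)
Lemma d1_log_derivative :
  (forall x y z, fps_app Phi (fps_app3 f' x y z) =
    fps_app3 f (fps_app Phi x) (fps_app Phi y) (fps_app Phi z)) ->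
  d1 br (E n) = (f' n - f n) *+ n.
Proof.
move=> Phif.
have lf : leads n (f - fps_const br) (f n).
  by rewrite -f0; apply: leads_tail => // i /fg_gap[].
have lf' : leads n (f' - fps_const br) (f' n).
  by rewrite -f'0; apply: leads_tail => // i /fg_gap'[].
suff [_ //] : leads n (Fps (fun m => d1 br (E m))) ((f' n - f n) *+ n).
apply: (leads_untwist3 Phi0) => x y z.
set X := fps_app Phi (fps_const x); set Y := fps_app Phi (fps_const y).
set Z := fps_app Phi (fps_const z).
pose B := fps_app3 (fps_const br) X Y Z.
pose P := fps_app Phi (fps_const (br x y z)).
have lH : leads n (B - P) ((f' n - f n) x y z).
  have -> : B - P = fps_app Phi (fps_app3 (f' - fps_const br)
      (fps_const x) (fps_const y) (fps_const z)) -
      fps_app3 (f - fps_const br) X Y Z.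
    rewrite !fps_app3B fps_appBr Phif fps_const_app3_const -/X -/Y -/Z -/B -/P.
    by rewrite opprB [RHS]addrC addrA subrK.
  rewrite alt3BE; apply: leadsB.
    have := leads_app3 (fps_const x) (fps_const y) (fps_const z) lf'.
    by move/(leads_appr Phi); rewrite Phi0 id_lfunE.
  have := leads_app3 X Y Z lf.
  by rewrite !fps_app_const Phi0 !id_lfunE.
(* D X = E X, and likewise for Y, Z, P; the two terms E P cancel. *)
have -> : fps_app3 (Fps (fun m => d1 br (E m))) X Y Z =
    euler (B - P) - fps_app E (B - P).
  rewrite fps_app3_d1 eulerB euler_app3 !EPhi fps_appBr -/X -/Y -/Z -/B -/P.
  by rewrite opprB [RHS]addrA subrK.
by rewrite alt3_mulrnE; apply: leads_euler_sub.
Qed.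

(** The commutator with theta replaces the failure to be a derivation. *)
Lemma delta1_log_derivative :
  (forall x, fps_app Phi (fps_app g' x) = fps_app g (fps_app Phi x)) ->
  delta1 theta (E n) = (g n - g' n) *+ n.
Proof.
move=> Phig.
have lg : leads n (g - fps_const theta) (g n).
  by rewrite -g0; apply: leads_tail => // i /fg_gap[].
have lg' : leads n (g' - fps_const theta) (g' n).
  by rewrite -g'0; apply: leads_tail => // i /fg_gap'[].
suff [_ //] : leads n (Fps (fun m => delta1 theta (E m))) ((g n - g' n) *+ n).
apply: (leads_untwist Phi0) => x.
set X := fps_app Phi (fps_const x).
pose B := fps_app (fps_const theta) X.
have tx : fps_app (fps_const theta) (fps_const x) = fps_const (theta x).
  by apply: fpsP => m; rewrite fps_const_app /=; case: m => //=; rewrite linear0.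
pose P := fps_app Phi (fps_const (theta x)).
have lH : leads n (P - B) ((g n - g' n) x).
  have -> : P - B = fps_app (g - fps_const theta) X -
      fps_app Phi (fps_app (g' - fps_const theta) (fps_const x)).
    rewrite !fps_appBl fps_appBr Phig tx -/X -/B -/P.
    by rewrite opprB [RHS]addrC addrA subrK.
  rewrite add_lfunE opp_lfunE; apply: leadsB.
    by have := leads_appl X lg; rewrite !fps_app_const Phi0 id_lfunE.
  by have := leads_appr Phi (leads_appl (fps_const x) lg'); rewrite Phi0 id_lfunE.
have -> : fps_app (Fps (fun m => delta1 theta (E m))) X =
    euler (P - B) - fps_app E (P - B).
  have eB : euler B = fps_app (fps_const theta) (fps_app E X).
    by rewrite euler_app euler_const fps_app0 add0r EPhi.
  rewrite fps_app_delta1 eulerB eB EPhi fps_appBr -/X -/B -/P.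
  by rewrite opprB [RHS]addrC addrA subrK.
by rewrite muln_lfunE; apply: leads_euler_sub.
Qed.

End Equivalence.
End Deformations.

Theorem proposition3p2 (F : closedFieldType) (charF0 : [pchar F] =i pred0)
    (L : vectType F) (br : alt3 L) (theta : 'End(L))
    (pairL : is_3LieDer (fun x y z => br x y z) theta)
    (f f' : fps (alt3 L)) (g g' : fps 'End(L))
    (def_fg : is_deformation br theta f g)
    (def_fg' : is_deformation br theta f' g')
    (equiv : equivalent_deformations f g f' g')
    (n : nat) (n_ge1 : (1 <= n)%N)
    (fg0 : forall i, (1 <= i < n)%N -> f i = 0 /\ g i = 0)
    (fg0' : forall i, (1 <= i < n)%N -> f' i = 0 /\ g' i = 0) :
  exists c c' : Z2 br theta,
    [/\ cochain_of c = (f n, g n), cochain_of c' = (f' n, g' n)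
      & \pi_(H2 br theta) c = \pi_(H2 br theta) c'].
Proof.
exists (Cocycle (infinitesimal_cocycle def_fg n_ge1 fg0)).
exists (Cocycle (infinitesimal_cocycle def_fg' n_ge1 fg0')); split=> //.
have [f_0 g_0 _] := def_fg; have [f'_0 g'_0 _] := def_fg'.
have [Phi [Phi0 Phif Phig]] := equiv.
have [E E0 EPhi] := log_derivative Phi0.
have dE := d1_log_derivative Phi0 E0 EPhi n_ge1 f_0 f'_0 fg0 fg0' Phif.
have deE := delta1_log_derivative Phi0 E0 EPhi n_ge1 g_0 g'_0 fg0 fg0' Phig.
have nF : n%:R != 0 :> F.
  by have /pcharf0P -> := charF0; rewrite -lt0n.
apply/eqP; rewrite eq_sym -Quotient.idealrBE; apply/asboolP.
have divn (V : lmodType F) (v : V) : n%:R^-1 *: (v *+ n) = v.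
  by rewrite -scaler_nat scalerA mulVf // scale1r.
exists (n%:R^-1 *: E n); rewrite partial1Z /partial1 dE deE -mulNrn opprB.
exact: (f_equal2 pair (divn _ _) (divn _ _)).
Qed.
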